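(* For any two permutations $\pi, \sigma \in \mathfrak{S}_n$, the following are equivalent: - for all $D \subseteq [n - 1]$, $\operatorname{ls}_D(\pi) = \operatorname{ls}_D(\sigma)$; - for all $1 \leq i < j \leq n$, $a_{i, j}(\pi) = a_{i, j}(\sigma)$.
   Context: $\mathfrak{S}_n$ is the set of permutations of $[n]=\{1,\dots,n\}$. For $I=\{i_1<\cdots<i_k\}\subseteq[n]$, $\pi_I=\pi(i_1)\cdots\pi(i_k)$, so $\pi_{[i,j]}=\pi(i)\pi(i+1)\cdots\pi(j)$. The descent set of a sequence $\tau$ of length $m$ is $\operatorname{Des}(\tau)=\{i\in[m-1] : \tau(i)>\tau(i+1)\}$. $\operatorname{ls}_D(\pi)=\max\{\#I : I\subseteq[n],\ \operatorname{Des}(\pi_I)=D\}$ (equal to $0$ if there is no such $I$). For $1\le i\le j\le n$, $a_{i,j}(\pi)=(\operatorname{is}(\pi_{[i,j]}),\operatorname{ds}(\pi_{[i,j]}))$, where $\operatorname{is}$ and $\operatorname{ds}$ denote the lengths of a longest increasing and a longest decreasing subsequence, respectively. *)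

(* Defs.v *)
From mathcomp Require Import all_boot all_order all_fingroup finmap.

Set Implicit Arguments.
Unset Strict Implicit.
Unset Printing Implicit Defensive.

Local Open Scope fset_scope.
Local Open Scope nat_scope.

(* Positions and values of a permutation are 0-based (elements of 'I_n), but
   descent sets are 1-based sets of naturals, so that Des tau is literally a
   subset of {1, ..., m - 1} when tau has length m. *)

Definition interval1 (m : nat) : {fset nat} := [fset i in iota 1 m].

(* pi_I as a word; [enum I] lists I in increasing order. *)
Definition subword (n : nat) (pi : 'S_n) (I : {set 'I_n}) : seq nat :=
  [seq val (pi i) | i <- enum I].

(* For 1 <= i, the i-th letter tau(i) is [nth 0 tau i.-1]. *)
Definition Des (tau : seq nat) : {fset nat} :=
  [fset i in interval1 (size tau).-1 | nth 0 tau i < nth 0 tau i.-1].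

(* The maximum over an empty range is 0. *)
Definition ls (n : nat) (D : {fset nat}) (pi : 'S_n) : nat :=
  \max_(I : {set 'I_n} | Des (subword pi I) == D) #|I|.

(* The subsequences of s are the [mask m s], for m a bit mask of length
   [size s]. *)
Definition longest_sorted (r : rel nat) (s : seq nat) : nat :=
  \max_(m : (size s).-tuple bool | sorted r (mask m s)) size (mask m s).

Definition is_len (s : seq nat) : nat := longest_sorted ltn s.
Definition ds_len (s : seq nat) : nat := longest_sorted gtn s.

Definition factor (n : nat) (pi : 'S_n) (i j : 'I_n) : seq nat :=
  subword pi [set k : 'I_n | i <= k <= j].

Definition a_pair (n : nat) (i j : 'I_n) (pi : 'S_n) : nat * nat :=
  (is_len (factor pi i j), ds_len (factor pi i j)).

(* Main.v *)
Require Import Defs.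
From mathcomp Require Import all_boot all_order all_fingroup finmap.
From mathcomp Require Import zify.

Set Implicit Arguments.
Unset Strict Implicit.
Unset Printing Implicit Defensive.

(** A subsequence with a prescribed descent set and length is an occurrence of
    a word of ascents and descents, so the values ls_D record exactly which
    words occur in pi: if D is the set of descents of a word w of size m, then w
    occurs iff m < ls_D(pi) ([lt_ls], [descents_prefix]).  Likewise the pairs
    a_(i,j) record which constant words, called runs below, occur in each
    window [[i, j]] of positions ([lt_longest_run]).  Hence the theorem
    compares, for two sequences, the words occurring in the whole sequence with
    the runs occurring in the windows.

    Runs determine words.  If w1 ends and w2 begins in opposite directions,
    then w1 w2 occurs in [[i, j]] iff w1 occurs in [[i, k]] and w2 occurs in
    [[k, j]] for some k.  The nontrivial half is [occurs_glue]: the end p of the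
    first occurrence and the start q of the second need not agree, but,
    whichever way p and q compare, one of them can be dropped.  Cutting a word
    into maximal runs gives [occurs_of_runs].

    Words determine runs.  The whole sequence spells the only word of maximal
    length occurring in it, so both sequences have the same step at each
    position.  Call a window adapted to a direction c when the steps entering
    and leaving it, if any, have direction opposite to c.  A run of direction c
    occurs in such a window iff its extension by all steps of the sequence
    before and after the window occurs in the whole sequence: those steps leave
    no room outside the window, and the words turn at its ends, so gluing
    applies ([occurs_sandwich]).  The other windows reduce to adapted ones: when
    the step entering at i has direction c, a run in [[i, j]] either is
    prolonged by position i-1 into a run that is longer by one in [[i-1, j]], or
    lies behind a later step of direction opposite to c ([occurs_run_left]).
    Induction on the left end, then symmetrically on the right end, gives
    [runs_of_occurs]. *)

(** * Words of ascents and descents in a sequence *)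

Section Occurrences.

Variable f : nat -> nat.

(** The direction [true] is a descent.  Counting ties as ascents makes both
    directions transitive and complementary for an arbitrary [f]. *)
Definition step (c : bool) (p q : nat) : bool :=
  (p < q) && ((f q < f p) == c).

Fixpoint reach (w : seq bool) (p q : nat) : Prop :=
  if w is c :: w' then exists2 r, step c p r & reach w' r q else p = q.

Definition occurs (w : seq bool) (i j : nat) : Prop :=
  exists p q, [/\ i <= p, reach w p q & q <= j].

Definition walk (p m : nat) : seq bool :=
  [seq f k.+1 < f k | k <- iota p m].

Lemma step_lt c p q : step c p q -> p < q.
Proof. by case/andP. Qed.

Lemma step_total c p q : p < q -> step c p q \/ step (~~ c) p q.
Proof.
by move=> lt_pq; rewrite /step lt_pq /=; case: (f q < f p) c => [] []; auto.
Qed.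

Lemma step_trans c p q r : step c p q -> step c q r -> step c p r.
Proof. by rewrite /step; case: c; lia. Qed.

Lemma reach_cat w1 w2 p q :
  reach (w1 ++ w2) p q <-> exists2 r, reach w1 p r & reach w2 r q.
Proof.
elim: w1 p => [|c w1 IH] p /=; first by split=> [|[r ->]]; [exists p|].
split=> [[r st /IH[s]]|[s [r st r1] r2]]; first by exists s => //; exists r.
by exists r => //; apply/IH; exists s.
Qed.

Lemma reach_leq w p q : reach w p q -> p + size w <= q.
Proof.
elim: w p => [|c w IH] p /=; first by move=> ->; rewrite addn0.
by case=> r /step_lt lt_pr /IH; lia.
Qed.

Lemma occurs_sub w i j i' j' :
  i' <= i -> j <= j' -> occurs w i j -> occurs w i' j'.
Proof.
by move=> le_i le_j [p [q [ip rw qj]]]; exists p, q; split=> //; lia.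
Qed.

Lemma occurs_leq w i j : occurs w i j -> i + size w <= j.
Proof. by case=> p [q [ip /reach_leq]]; lia. Qed.

Lemma occurs_nil i j : i <= j -> occurs [::] i j.
Proof. by exists i, i. Qed.

Lemma occurs_split w1 w2 i j : occurs (w1 ++ w2) i j ->
  exists k, [/\ i <= k, k <= j, occurs w1 i k & occurs w2 k j].
Proof.
case=> p [q [ip /reach_cat[k r1 r2] qj]].
have le_pk := reach_leq r1; have le_kq := reach_leq r2.
by exists k; split; [lia|lia|exists p, k|exists k, q].
Qed.

Lemma occurs_catl w1 w2 i j : occurs (w1 ++ w2) i j -> occurs w1 i j.
Proof. by case/occurs_split=> k [_ kj o _]; apply: occurs_sub o. Qed.

Definition turn (w1 w2 : seq bool) : bool :=
  [|| nilp w1, nilp w2 | last true w1 != head true w2].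

(** Let p be the end of the occurrence of [w1] and q >= p the start of that of
    [w2].  If the step from p to q continues the last step of [w1], then q
    replaces p as the end of [w1]; otherwise it has the direction of the first
    step of [w2], and p replaces q as the start of [w2]. *)
Lemma occurs_glue w1 w2 i k j : turn w1 w2 ->
  occurs w1 i k -> occurs w2 k j -> occurs (w1 ++ w2) i j.
Proof.
case/lastP: w1 => [_ /occurs_leq /= le_ik|w1 c1].
  by apply: occurs_sub => //; lia.
case: w2 => [_ o1 /occurs_leq /= le_kj|c w2].
  by rewrite cats0; apply: occurs_sub o1 => //; lia.
have -> : turn (rcons w1 c1) (c :: w2) = (c1 == ~~ c).
  rewrite /turn /nilp size_rcons last_rcons /=; by case: c1 c => [] [].
move/eqP=> ->; rewrite -cats1.
case=> p0 [p [ip0 /reach_cat[p' r1 [p'' st1 /= ?]] pk]]; subst p''.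
case=> q [q0 [kq [q' st2 r2] q0j]].
exists p0, q0; split=> //; apply/reach_cat.
case: (eqVneq p q) => [eq_pq | ne_pq].
  exists p; last by rewrite eq_pq; exists q'.
  by apply/reach_cat; exists p' => //; exists p.
have lt_pq : p < q by lia.
case: (step_total c lt_pq) => st.
- exists p; last by exists q' => //; apply: step_trans st st2.
  by apply/reach_cat; exists p' => //; exists p.
- exists q; last by exists q'.
  by apply/reach_cat; exists p' => //; exists q => //; apply: step_trans st1 st.
Qed.

Lemma reach_walk p m : reach (walk p m) p (p + m).
Proof.
elim: m p => [|m IH] p /=; first by rewrite addn0.
exists p.+1; first by rewrite /step ltnSn eqxx.
by rewrite addnS -addSn; apply: IH.
Qed.

(** Without slack every position must be visited. *)
Lemma reach_tight w p : reach w p (p + size w) -> w = walk p (size w).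
Proof.
elim: w p => [|c w IH] p //= [r st rw].
have ? : r = p.+1 by move: (step_lt st) (reach_leq rw); lia.
subst r; move: rw; rewrite addnS -addSn => /IH eq_w; rewrite {1}eq_w.
by case/andP: st => _ /eqP <-.
Qed.

Lemma occurs_walk p m : occurs (walk p m) p (p + m).
Proof. by exists p, (p + m); split=> //; apply: reach_walk. Qed.

Lemma occurs_tight w : occurs w 0 (size w) -> w = walk 0 (size w).
Proof.
case=> p [q [_ r le_q]]; have le_pq := reach_leq r.
have ? : p = 0 by lia.
subst p; apply: reach_tight; suff -> : 0 + size w = q by [].
by lia.
Qed.

Lemma size_walk p m : size (walk p m) = m.
Proof. by rewrite size_map size_iota. Qed.

(** By transitivity, consecutive steps that all have direction [c] cannot
    compose to a step of direction [~~ c]. *)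
Lemma step_between c p q : p < q -> step (~~ c) p q ->
  exists2 k, p <= k < q & step (~~ c) k k.+1.
Proof.
elim: q => // q IH lt_pq st.
case: (@step_total c q q.+1) => // st'; last by exists q => //; lia.
have lt : p < q.
  case: (eqVneq p q) => [e|]; last by lia.
  by move: st st'; rewrite e /step; case: (c); lia.
case: (IH lt) => [|k kr sk]; last by exists k => //; lia.
case: (@step_total c p q) => // st2.
by move: (step_trans st2 st') st; rewrite /step; case: (c); lia.
Qed.

(** Let q be the start of the run.  If i -> q has direction [c], then i can be
    prepended.  Otherwise some consecutive step between i and q has direction
    [~~ c], and the run lies behind it. *)
Lemma occurs_run_left c b i j : step c i i.+1 ->
  occurs (nseq b c) i.+1 j <->
  (occurs (nseq b.+1 c) i j \/
   exists k, [/\ i < k, step (~~ c) k k.+1 & occurs (nseq b c) k.+1 j]).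
Proof.
move=> sti; split; last first.
  case=> [|[k [ik _]]]; last by apply: occurs_sub => //; lia.
  case=> p [q [ip [r /step_lt pr rw] qj]].
  by exists r, q; split=> //; lia.
case=> q [q0 [iq rw q0j]].
case: (@step_total c i q) => // st.
  by left; exists i, q0; split=> //; exists q.
case: (step_between _ st) => // k kr sk; right; exists k; split=> //; last first.
  by exists q, q0; split=> //; lia.
case: (eqVneq k i) => [e|]; last by lia.
by move: sti sk; rewrite e /step; case: (c); lia.
Qed.

(** The mirror image of [occurs_run_left], at the end of the run. *)
Lemma occurs_run_right c b i j : step c j j.+1 ->
  occurs (nseq b c) i j <->
  (occurs (nseq b.+1 c) i j.+1 \/
   exists k, [/\ k < j, step (~~ c) k k.+1 & occurs (nseq b c) i k]).
Proof.
have nseqSr m : nseq m.+1 c = nseq m c ++ [:: c].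
  by rewrite -(addn1 m) nseqD.
move=> stj; split; last first.
  case=> [|[k [ik _]]]; last by apply: occurs_sub => //; lia.
  rewrite nseqSr; case=> p [q [ip /reach_cat[r r1 [s /step_lt rs /= e]] qj]].
  by exists p, r; split=> //; lia.
case=> p [q [ip rw qj]].
case: (@step_total c q j.+1) => // st.
  left; exists p, j.+1; split=> //; rewrite nseqSr.
  by apply/reach_cat; exists q => //; exists j.+1.
case: (step_between _ st) => // k kr sk; right; exists k; split=> //; last first.
  by exists p, q; split=> //; lia.
case: (eqVneq k j) => [e|]; last by lia.
by move: stj sk; rewrite e /step; case: (c); lia.
Qed.

(** The added walks turn at i and j, so an occurrence in the window can be glued
    to them; conversely they need i steps before the run and N - j steps after
    it, which confines the run to the window. *)
Lemma occurs_sandwich c b i j N : 0 < b -> i <= N -> j <= N ->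
  (i = 0 \/ step (~~ c) i.-1 i) -> (j = N \/ step (~~ c) j j.+1) ->
  occurs (nseq b c) i j <->
  occurs (walk 0 i ++ nseq b c ++ walk j (N - j)) 0 N.
Proof.
move=> b0 iN jN li rj; split; last first.
  case/occurs_split=> k [_ _ /occurs_leq]; rewrite size_walk => ik.
  case/occurs_split=> l [_ _ o /occurs_leq]; rewrite size_walk => lN.
  by apply: occurs_sub o; lia.
move=> o; apply: (@occurs_glue _ _ _ i); first last.
- apply: (@occurs_glue _ _ _ j) => //.
    case: rj => [->|st]; first by rewrite subnn /turn /nilp /= orbT.
    case: (posnP (N - j)) => [->|]; first by rewrite /turn /nilp /= orbT.
    case: b b0 {o} => // b _; case: (N - j) => // m _.
    have last_c : last c (nseq b c) = c by elim: b.
    by move: st; rewrite /step /turn /nilp /= last_c; case: (c); lia.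
  by have := occurs_walk j (N - j); rewrite subnKC.
- exact: (occurs_walk 0 i).
case: li => [->|]; first by [].
case: i {iN o} => // i st; case: b b0 => // b _.
have last_walk : last true (walk 0 i.+1) = (f i.+1 < f i).
  by rewrite /walk -(addn1 i) iotaD map_cat last_cat /= add0n addn1.
apply/orP; right; apply/orP; right; rewrite last_walk.
have -> : head true (nseq b.+1 c ++ walk j (N - j)) = c by [].
by move: st; rewrite /step /=; case: (c); lia.
Qed.

End Occurrences.

(** * Comparing two sequences *)

(** Induction on the word from the left, carrying the run that is being read, so
    that the word is cut exactly where its direction changes. *)
Lemma occurs_of_runs (f g : nat -> nat) N :
  (forall c b i j, j <= N -> occurs f (nseq b c) i j -> occurs g (nseq b c) i j) ->
  forall w i j, j <= N -> occurs f w i j -> occurs g w i j.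
Proof.
move=> H w.
suff gen c b : forall i j, j <= N ->
    occurs f (nseq b c ++ w) i j -> occurs g (nseq b c ++ w) i j.
  exact: (gen true 0).
elim: w c b => [|d w IH] c b i j jN; first by rewrite cats0; apply: H.
case: (eqVneq d c) => [->|ne_dc].
  by rewrite -cat_rcons -(cats1 (nseq b c)) -(nseqD b 1); apply: IH.
case/occurs_split=> k [ik kj o1 o2].
apply: (@occurs_glue _ _ _ _ k); last exact: (IH d 1).
  case: b {o1} => [|b] //; rewrite /turn /=.
  have -> : last c (nseq b c) = c by elim: b.
  by rewrite eq_sym ne_dc.
by apply: H o1; lia.
Qed.

(** [good c i] and [goodr c j] say that the window [[i, j]] is adapted to the
    direction [c] on its left and right end; [base] treats adapted windows,
    [left] removes the condition on the left end, and [right] the one on the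
    right end. *)
Lemma runs_of_occurs (f g : nat -> nat) N :
  (forall w, occurs f w 0 N <-> occurs g w 0 N) ->
  forall c b i j, j <= N -> occurs f (nseq b c) i j -> occurs g (nseq b c) i j.
Proof.
move=> H.
(* Both sequences have the same steps: the walk of f fills [0, N]. *)
have eqw : walk f 0 N = walk g 0 N.
  have := @occurs_tight g (walk f 0 N); rewrite size_walk => -> //.
  by apply/H; apply: (occurs_walk f 0 N).
have eqs k : k < N -> (f k.+1 < f k) = (g k.+1 < g k).
  move=> kN; have := congr1 (fun w => nth true w k) eqw.
  by rewrite !(nth_map 0) ?size_iota // !nth_iota.
have eqst c k : k < N -> step f c k k.+1 = step g c k k.+1.
  by move=> kN; rewrite /step eqs.
have eqwalk p m : p + m <= N -> walk f p m = walk g p m.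
  move=> le; apply/eq_in_map => k; rewrite mem_iota => kr; apply: eqs; lia.
pose good c i := i = 0 \/ step f (~~ c) i.-1 i.
pose goodr c j := j = N \/ step f (~~ c) j j.+1.
have base c b i j : j <= N -> good c i -> goodr c j ->
    occurs f (nseq b c) i j <-> occurs g (nseq b c) i j.
  move=> jN gi gj.
  case: (leqP i j) => ij; last by split=> /occurs_leq; lia.
  case: (posnP b) => [->|b0]; first by split=> _; apply: occurs_nil.
  have iN : i <= N by lia.
  have gi' : i = 0 \/ step g (~~ c) i.-1 i.
    case: gi => [|st]; [by left|right].
    case: i st {ij iN} (leq_trans ij jN) => [|i] /=; first by rewrite /step.
    by move=> st iN; rewrite -eqst.
  have gj' : j = N \/ step g (~~ c) j j.+1.
    case: gj => [|st]; [by left|].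
    case: (eqVneq j N) => [|ne]; [by left|right].
    by rewrite -eqst //; lia.
  have := occurs_sandwich b0 iN jN gi gj; have := occurs_sandwich b0 iN jN gi' gj'.
  rewrite -(eqwalk 0 i) // -(eqwalk j (N - j)); last by lia.
  by move=> -> ->; apply: H.
have left c j : j <= N -> goodr c j -> forall i b,
    occurs f (nseq b c) i j <-> occurs g (nseq b c) i j.
  move=> jN gj; elim=> [|i IH] b; first by apply: base => //; left.
  case: (leqP i.+1 j) => ij; last by split=> /occurs_leq; lia.
  case: (@step_total f c i i.+1) => // st; last by apply: base => //; right.
  have st' : step g c i i.+1 by rewrite -eqst //; lia.
  have E k : occurs f (nseq b c) k.+1 j \/ occurs g (nseq b c) k.+1 j -> k < N.
    by case=> /occurs_leq; lia.
  rewrite (occurs_run_left b j st) (occurs_run_left b j st') IH.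
  split=> -[|[k [ik sk o]]]; [by left|right|by left|right]; exists k.
    have kN : k < N by apply: E; left.
    by split=> //; [rewrite -eqst|apply/(base c b k.+1 j jN) => //; right].
  have kN : k < N by apply: E; right.
  have sk' : step f (~~ c) k k.+1 by rewrite eqst.
  by split=> //; apply/(base c b k.+1 j jN) => //; right.
suff right c i : forall d b, d <= N ->
    occurs f (nseq b c) i (N - d) <-> occurs g (nseq b c) i (N - d).
  move=> c b i j jN; have := right c i (N - j) b (leq_subr _ _).
  by rewrite subKn // => ->.
(* Induction on the distance d from the right end of the window to N. *)
elim=> [|d IH] b dN; first by rewrite subn0; apply: left => //; left.
have jN : N - d.+1 < N by lia.
move: {IH} (fun b => IH b (ltnW dN)); have -> : N - d = (N - d.+1).+1 by lia.
move: (N - d.+1) jN => j jN IH {d dN}.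
case: (@step_total f c j j.+1) => // st; last by apply: left; [lia|right].
have st' : step g c j j.+1 by rewrite -eqst.
rewrite (occurs_run_right b i st) (occurs_run_right b i st') IH.
split=> -[|[k [kj sk o]]]; [by left|right|by left|right]; exists k.
  by split=> //; [rewrite -eqst //; lia|apply/left => //; [lia|right]].
have sk' : step f (~~ c) k k.+1 by rewrite eqst //; lia.
by split=> //; apply/left => //; [lia|right].
Qed.

(** * Words of sequences, and descent sets *)

Definition dword (s : seq nat) : seq bool :=
  if s is x :: s' then pairmap (fun a b => b < a) x s' else [::].

Definition descents (w : seq bool) : {fset nat} :=
  [fset i in interval1 (size w) | nth false w i.-1]%fset.

Definition run_order (c : bool) : rel nat := if c then gtn else ltn.

Lemma size_dword s : size (dword s) = (size s).-1.
Proof. by case: s => //= x s; rewrite size_pairmap. Qed.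

Lemma mem_descents w i : (i \in descents w) = (0 < i) && nth false w i.-1.
Proof.
rewrite !inE /= mem_iota; case: i => //= i.
by case: (ltnP i (size w)) => le_w; [case: nth; lia|rewrite nth_default //; lia].
Qed.

Lemma Des_dword s : Des s = descents (dword s).
Proof.
apply/fsetP => i; rewrite mem_descents !inE /= mem_iota.
case: s => [|x s] /=; first by rewrite !nth_nil ltnn !andbF.
case: i => //= i.
rewrite add1n (ltnS i.+1); case: (ltnP i (size s)) => [lt_s|le_s].
  by rewrite (nth_pairmap 0).
by rewrite [RHS]nth_default ?size_pairmap.
Qed.

(** A descent set determines its word up to trailing ascents. *)
Lemma descents_prefix w w' : descents w = descents w' -> size w <= size w' ->
  w = take (size w) w'.
Proof.
move=> eqD le_w; apply: (@eq_from_nth _ false); first by rewrite size_takel.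
move=> i lt_i; rewrite nth_take //.
by have := congr1 (fun D : {fset nat} => i.+1 \in D) eqD; rewrite /= !mem_descents.
Qed.

Lemma dword_run c s : uniq s ->
  (dword s == nseq (size s).-1 c) = sorted (run_order c) s.
Proof.
case: s => // x s; elim: s x => [|y s IH] x //= /andP[]; rewrite inE negb_or.
case/andP=> ne_xy _ /IH /= <-; rewrite eqseq_cons; congr (_ && _).
by rewrite /run_order; case: c {IH}; rewrite /=; lia.
Qed.

(** * Occurrences as lists of positions *)

Lemma reachP f w p q : reach f w p q <->
  exists ks, [/\ path ltn p ks, last p ks = q & dword (map f (p :: ks)) = w].
Proof.
elim: w p => [|c w IH] p /=.
  split=> [->|[ks [_ <-]]]; first by exists [::].
  by case: ks.
split=> [[r /andP[lt_pr /eqP st] /IH[ks [pr lr dr]]]|[[|r ks] [//=]]].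
  by exists (r :: ks); split=> //=; [rewrite lt_pr|rewrite st -dr].
case/andP=> lt_pr pr lr [st dr]; exists r; first by rewrite /step lt_pr st eqxx.
by apply/IH; exists ks.
Qed.

Lemma occursP f w i j : occurs f w i j <->
  exists ks, [/\ sorted ltn ks, 0 < size ks, all (fun k => i <= k <= j) ks
    & dword (map f ks) = w].
Proof.
split=> [[p [q [ip /reachP[ks [pk lk dk]] qj]]]|
        [[|p ks] [//= pk _ /andP[pij kij] dk]]].
  exists (p :: ks); split=> //.
  have le_last : all (fun k => k <= last p ks) (p :: ks).
    elim: ks p pk {ip lk dk} => [|k ks IH] p /=; first by rewrite leqnn.
    by case/andP=> lt_pk /IH /= /andP[le_k ->]; rewrite le_k; lia.
  have ge_p : all (leq p) (p :: ks).
    by rewrite /= leqnn /= (sub_all _ (order_path_min ltn_trans pk)) // => k /ltnW.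
  apply/allP => k kin; move/allP/(_ k kin): le_last; move/allP/(_ k kin): ge_p.
  by rewrite lk; lia.
exists p, (last p ks); split; [by case/andP: pij|by apply/reachP; exists ks|].
have /allP/(_ (last p ks)) : all (fun k => i <= k <= j) (p :: ks) by rewrite /= pij.
by rewrite mem_last => /(_ isT)/andP[].
Qed.

(** * Longest subsequences as occurrences *)

Lemma lt_bigmax (I : finType) (P : pred I) (F : I -> nat) m :
  m < \max_(i | P i) F i <-> exists2 i, P i & m < F i.
Proof.
split=> [|[i Pi lt_m]]; last exact: (bigmax_sup i).
rewrite ltnNge => /bigmax_leqP not_le.
case: (pickP (fun i => P i && (m < F i))) => [i /andP[Pi lt_m]|none].
  by exists i.
by case: not_le => i Pi; move: (none i); rewrite Pi /= ltnNge => /negbFE.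
Qed.

Lemma lt_longest_sorted r s b : b < longest_sorted r s <->
  exists t, [/\ subseq t s, sorted r t & b < size t].
Proof.
split=> [/lt_bigmax[m sm lt_b]|[t [/subseqP[m sz_m def_t] st lt_b]]].
  by exists (mask m s); split=> //; apply: mask_subseq.
by apply/lt_bigmax; exists (tcast sz_m (in_tuple m)); rewrite val_tcast /= -def_t.
Qed.

Lemma sorted_subseq_iota ks i m :
  sorted ltn ks -> all (fun k => i <= k < i + m) ks -> subseq ks (iota i m).
Proof.
move=> sk /allP kin; have -> : ks = [seq k <- iota i m | k \in ks].
  apply: (irr_sorted_eq ltn_trans ltnn) => //.
    by apply: sorted_filter; [apply: ltn_trans|apply: iota_ltn_sorted].
  move=> k; rewrite mem_filter mem_iota.
  by case: (boolP (k \in ks)) => // /kin ->.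
exact: filter_subseq.
Qed.

Section Permutation.

Variables (n : nat) (pi : 'S_n).

(** [pi] as a sequence indexed by all naturals, so that windows and steps need
    no proofs that positions are in range. *)
Definition letter (k : nat) : nat := oapp (fun i => val (pi i)) 0 (insub k).

Definition positions (I : {set 'I_n}) : seq nat := map val (enum I).

Lemma letter_inj : {in gtn n &, injective letter}.
Proof.
move=> k l kn ln; rewrite /letter !insubT //= => /val_inj /perm_inj.
by move/(congr1 val).
Qed.

Lemma subword_letter I : subword pi I = map letter (positions I).
Proof. by rewrite -map_comp; apply: eq_map => i /=; rewrite /letter valK. Qed.

Lemma size_positions I : size (positions I) = #|I|.
Proof. by rewrite size_map -cardE. Qed.

Lemma mem_positions I k : (k \in positions I) = [exists i in I, val i == k].
Proof.
apply/mapP/exists_inP => [[i]|[i iI /eqP <-]]; last by exists i; rewrite ?mem_enum.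
by rewrite mem_enum => iI ->; exists i.
Qed.

Lemma sorted_positions I : sorted ltn (positions I).
Proof.
apply: (@subseq_sorted _ _ ltn_trans _ (iota 0 n)); last exact: iota_ltn_sorted.
rewrite -val_enum_ord; apply: map_subseq.
by rewrite [enum 'I_n]/enum_mem filter_predT filter_subseq.
Qed.

Lemma positions_exist ks : sorted ltn ks -> all (gtn n) ks ->
  exists I, positions I = ks.
Proof.
move=> sk /allP kn; exists [set i : 'I_n | val i \in ks].
apply: (irr_sorted_eq ltn_trans ltnn (sorted_positions _) sk) => k.
rewrite mem_positions; apply/exists_inP/idP => [[i]|kin].
  by rewrite inE => iin /eqP <-.
by exists (Ordinal (kn k kin)); rewrite ?inE.
Qed.

(** The length of w may exceed m: [descents] forgets trailing ascents, which is
    where [ls] takes its maximum. *)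
Lemma lt_ls D m : 0 < n -> m < ls D pi <->
  exists w, [/\ occurs letter w 0 n.-1, m <= size w & descents w = D].
Proof.
move=> n0; split=> [/lt_bigmax[I /eqP defD lt_m]|[w [/occursP[ks]]]].
  exists (dword (subword pi I)); rewrite -Des_dword defD; split=> //.
    apply/occursP; exists (positions I); rewrite sorted_positions -subword_letter.
    split=> //; first by rewrite size_positions; lia.
    apply/allP => k; rewrite mem_positions => /exists_inP[[i i_n] _ /eqP <-] /=.
    by lia.
  by rewrite size_dword subword_letter size_map size_positions; lia.
case=> sk k0 kn <- le_m defD.
case: (positions_exist sk) => [|I defI].
  by apply: sub_all kn => k /=; lia.
move: le_m k0 defD; rewrite size_dword size_map -defI -subword_letter -Des_dword.
rewrite size_positions => le_m k0 defD; apply/lt_bigmax.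
by exists I; [rewrite defD|lia].
Qed.

Lemma factor_letter (i j : 'I_n) : factor pi i j = map letter (iota i (j.+1 - i)).
Proof.
rewrite /factor subword_letter; congr map.
apply: (irr_sorted_eq ltn_trans ltnn (sorted_positions _) (iota_ltn_sorted _ _)).
move=> k; rewrite mem_positions mem_iota; apply/exists_inP/idP => [[l]|kr].
  by rewrite inE => lr /eqP <- /=; lia.
have kn : k < n by have := ltn_ord j; lia.
by exists (Ordinal kn); rewrite ?inE //=; lia.
Qed.

Lemma lt_longest_run c b (i j : 'I_n) : i <= j ->
  b < longest_sorted (run_order c) (factor pi i j) <->
  occurs letter (nseq b c) i j.
Proof.
move=> le_ij; rewrite factor_letter.
have uniq_letters ks : sorted ltn ks -> all (fun k => i <= k <= j) ks ->
    uniq (map letter ks).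
  move=> sk /allP kin; rewrite map_inj_in_uniq.
    exact: (sorted_uniq ltn_trans ltnn sk).
  have lt_n k : k \in ks -> k \in gtn n.
    by move/kin => kr; rewrite inE; have := ltn_ord j; lia.
  by move=> k l /lt_n kn /lt_n ln; apply: letter_inj.
split=> [/lt_longest_sorted[t [/subseqP[m sz_m ->]]]|/occursP[ks [sk k0 kin def_w]]].
  rewrite -map_mask; set ks := mask m _ => st; rewrite size_map => lt_b.
  have sub_ks : subseq ks (iota i (j.+1 - i)) by apply: mask_subseq.
  have sk : sorted ltn ks.
    exact: (subseq_sorted ltn_trans sub_ks (iota_ltn_sorted _ _)).
  have kin : all (fun k => i <= k <= j) ks.
    by apply/allP => k /(mem_subseq sub_ks); rewrite mem_iota; lia.
  move: st; rewrite -dword_run ?uniq_letters // => /eqP def_w.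
  apply: (@occurs_catl _ _ (nseq ((size ks).-1 - b) c)); rewrite -nseqD.
  apply/occursP; exists ks; split=> //; first by lia.
  by rewrite def_w size_map; congr nseq; lia.
apply/lt_longest_sorted; exists (map letter ks); split.
- apply: map_subseq; apply: sorted_subseq_iota => //.
  by apply: sub_all kin => k; lia.
- have := congr1 size def_w; rewrite size_dword size_nseq size_map => sz.
  by rewrite -dword_run ?uniq_letters // size_map sz def_w.
- by have := congr1 size def_w; rewrite size_dword size_nseq !size_map; lia.
Qed.

End Permutation.

Lemma eq_from_lt (a b : nat) : (forall m, m < a <-> m < b) -> a = b.
Proof.
move=> eq_lt; apply/eqP; rewrite eqn_leq; apply/andP; split; rewrite leqNgt.
  by apply/negP => /eq_lt; rewrite ltnn.
by apply/negP => /eq_lt; rewrite ltnn.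
Qed.

(** * The equivalence *)

Lemma a_pair_runs n (pi sigma : 'S_n) (i j : 'I_n) : i <= j ->
  a_pair i j pi = a_pair i j sigma <->
  forall c b, occurs (letter pi) (nseq b c) i j <->
              occurs (letter sigma) (nseq b c) i j.
Proof.
move=> le_ij; split=> [[eq_is eq_ds] c b|eq_runs].
  rewrite -!(lt_longest_run _ _ _ le_ij).
  by case: c; [move: eq_ds|move: eq_is]; rewrite /is_len /ds_len /run_order => ->.
congr pair; apply: eq_from_lt => m.
  by rewrite (lt_longest_run pi false m le_ij) eq_runs -lt_longest_run.
by rewrite (lt_longest_run pi true m le_ij) eq_runs -lt_longest_run.
Qed.

(** The longest subsequence of sigma with the descent set of w spells w followed
    by ascents, provided it is long enough. *)
Lemma ls_occurs n (pi sigma : 'S_n) w : 0 < n ->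
  ls (descents w) pi = ls (descents w) sigma ->
  occurs (letter pi) w 0 n.-1 -> occurs (letter sigma) w 0 n.-1.
Proof.
move=> n0 eq_ls o.
have : size w < ls (descents w) sigma by rewrite -eq_ls; apply/lt_ls => //; exists w.
case/lt_ls=> // w' [o' le_w eqD].
rewrite (descents_prefix (esym eqD) le_w).
by apply: (@occurs_catl _ _ (drop (size w) w')); rewrite cat_take_drop.
Qed.

Theorem proposition4p18 (n : nat) (pi sigma : 'S_n) :
  (forall D : {fset nat}, (D `<=` interval1 n.-1)%fset ->
     ls D pi = ls D sigma)
  <->
  (forall i j : 'I_n, i < j -> a_pair i j pi = a_pair i j sigma).
Proof.
case: (posnP n) => [n0|n0].
  have -> : pi = sigma by apply/permP => -[k kn]; exfalso; lia.
  by [].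
split=> [eq_ls i j lt_ij|eq_a D _].
  have le_j : j <= n.-1 by have := ltn_ord j; lia.
  have eq_ls_word w : size w <= n.-1 -> ls (descents w) pi = ls (descents w) sigma.
    move=> le_w; apply: eq_ls; apply/fsubsetP => k.
    by rewrite !inE /= !mem_iota; lia.
  have eq_occ w : occurs (letter pi) w 0 n.-1 <-> occurs (letter sigma) w 0 n.-1.
    by split=> o; have := occurs_leq o; rewrite add0n => le_w;
      apply: ls_occurs o => //; rewrite eq_ls_word.
  apply/(a_pair_runs pi sigma (ltnW lt_ij)) => c b.
  by split; apply: (runs_of_occurs _ le_j) => w; rewrite eq_occ.
have eq_runs c b i j : j <= n.-1 ->
    occurs (letter pi) (nseq b c) i j <-> occurs (letter sigma) (nseq b c) i j.
  move=> le_j; case: (ltngtP i j) => [lt_ij|gt_ij|->].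
  - have [i_n j_n] : i < n /\ j < n by lia.
    have le_ij : Ordinal i_n <= Ordinal j_n by apply: ltnW.
    by have /(a_pair_runs _ _ le_ij) := eq_a (Ordinal i_n) (Ordinal j_n) lt_ij; apply.
  - by split=> /occurs_leq; lia.
  - case: b => [|b]; first by split=> _; apply: occurs_nil.
    by split=> /occurs_leq; rewrite size_nseq; lia.
have eq_occ w : occurs (letter pi) w 0 n.-1 <-> occurs (letter sigma) w 0 n.-1.
  by split; apply: occurs_of_runs (leqnn _) => c b i j /(eq_runs c b i j)[].
apply: eq_from_lt => m; rewrite !lt_ls //.
by split=> -[w [/eq_occ o le_m defD]]; exists w.
Qed.
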